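(* Suppose that there exists a constant $N$ such that, for all integers $a$ and all integers $b\ge 1$, every set of positive integers $x$ satisfying $x^2\equiv a\pmod b$, in which any two elements differ by less than $b^{1/2}$, has at most $N$ elements. Then $\sigma(k)=O(k^{1/2})$, i.e. there is a constant $C$ with $\sigma(k)\le C k^{1/2}$ for all integers $k\ge1$.
   Context: For a positive integer $k$, $\sigma(k)$ denotes the maximum, over all positive integers $a$ and $b$, of the number of squares (of integers) among $a+b,a+2b,\dots,a+kb$. *)

(* Defs.v *)
From HB Require Import structures.
From mathcomp Require Import all_boot all_order all_algebra.
From mathcomp Require Import all_classical all_reals.

Set Implicit Arguments.
Unset Strict Implicit.
Unset Printing Implicit Defensive.

Import Order.TTheory GRing.Theory Num.Theory.
Local Open Scope ring_scope.

Definition is_square (n : int) : Prop := exists m : int, n = m ^+ 2.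

(* The terms a + b, ..., a + k b are indexed by i : 'I_k, shifted by one.
   Counting indices is counting values, as the terms are distinct for b > 0. *)
Definition num_squares (a b : int) (k : nat) : nat :=
  #|[pred i : 'I_k | `[< is_square (a + i.+1%:Z * b) >]]|.

Definition attained (k m : nat) : bool :=
  `[< exists a b : int, [/\ 0 < a, 0 < b & num_squares a b k = m] >].

Lemma attained_ex (k : nat) : exists m, attained k m.
Proof. by exists (num_squares 1 1 k); apply/asboolP; exists 1, 1. Qed.

Lemma attained_le (k m : nat) : attained k m -> (m <= k)%N.
Proof.
move=> /asboolP[a [b [_ _ <-]]].
by rewrite -[leqRHS]card_ord; exact: max_card.
Qed.

Definition sigma (k : nat) : nat := ex_maxn (attained_ex k) (@attained_le k).

(* Main.v *)
(* The positive roots of the squares among a + b, ..., a + k b lie between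
   sqrt a and sqrt (a + k b) <= sqrt a + sqrt k * sqrt b, and all of them solve
   x^2 = a mod b. Cutting this range into at most sqrt k + 1 half-open blocks
   of length sqrt b, each block contains at most N roots by hypothesis. *)
Require Import Defs.
From HB Require Import structures.
From mathcomp Require Import all_boot all_order all_algebra.
From mathcomp Require Import all_classical all_reals.
From mathcomp Require Import lra.

Set Implicit Arguments.
Unset Strict Implicit.
Unset Printing Implicit Defensive.

Import Order.TTheory GRing.Theory Num.Theory.
Local Open Scope classical_set_scope.
Local Open Scope ring_scope.

Lemma card_le_fibers (T : finType) (A : {pred T}) (g : T -> nat) (m n : nat) :
  (forall i, i \in A -> (g i < m)%N) ->
  (forall j, (#|[pred i in A | g i == j]| <= n)%N) -> (#|A| <= m * n)%N.
Proof.
case: m => [|m] gm gn.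
  by rewrite mul0n leqn0; apply/eqP/eq_card0 => i; apply/negP => /gm.
rewrite -sum1_card (partition_big (fun i => inord (g i) : 'I_m.+1) predT) //=.
rewrite -[X in (_ <= X * _)%N]card_ord -sum_nat_const; apply: leq_sum => j _.
rewrite sum1_card; apply: leq_trans (gn j); apply: subset_leq_card.
apply/fintype.subsetP => i /andP[iA /eqP<-].
by rewrite !inE iA inordK ?eqxx ?gm.
Qed.

(** Bridge between the two notions of size: the hypothesis on roots bounds a classical set of
    integers, whereas squares are counted by [#|A|] over indices. *)
Lemma card_le_inj_image (T : finType) (U : Type) (A : {pred T}) (f : T -> U)
    (n : nat) :
  {in A &, injective f} -> ([set f i | i in [set` A]] #<= `I_n)%card ->
  (#|A| <= n)%N.
Proof.
move=> f_inj fA.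
have Af : ([set` A] #<= [set f i | i in [set` A]])%card.
  have: ([set f i | i in [set` A]] #= [set` A])%card.
    by apply: inj_card_eq => x y; rewrite !inE; exact: f_inj.
  by move=> /card_eqPle[].
apply: leq_trans (geq_card_fset_set (card_le_trans Af fA)).
rewrite cardE; apply: uniq_leq_size => [|x]; first exact: enum_uniq.
by rewrite mem_enum => xA; rewrite in_fset_set ?inE //; exact: finite_finset.
Qed.

Lemma sqrt_block_lt (R : realType) (a k b x : R) :
  0 <= a -> 0 < b -> 0 <= k -> 0 <= x -> x ^+ 2 <= a + k * b ->
  (Num.truncn ((x - Num.sqrt a) / Num.sqrt b) < (Num.truncn (Num.sqrt k)).+1)%N.
Proof.
move=> a0 b0 k0 x0 xle; rewrite ltnS; apply: le_truncn.
have sb0 : 0 < Num.sqrt b by rewrite sqrtr_gt0.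
rewrite ler_pdivrMr // lerBlDr -ler_sqr ?nnegrE ?addr_ge0 ?mulr_ge0 ?sqrtr_ge0//.
apply: le_trans xle _; rewrite sqrrD exprMn !sqr_sqrtr //; last exact: ltW.
(* The square of [sqrt k * sqrt b + sqrt a] exceeds [a + k * b] by twice this nonnegative
   product. *)
have := mulr_ge0 (mulr_ge0 (sqrtr_ge0 k) (sqrtr_ge0 b)) (sqrtr_ge0 a).
lra.
Qed.

(** Both numbers lie in one interval [[n, n + 1)]. Nonnegativity matters, since [truncn] sends every
    negative number to 0. *)
Lemma truncn_eq_dist (R : realType) (u v : R) :
  0 <= u -> 0 <= v -> Num.truncn u = Num.truncn v -> `|u - v| < 1.
Proof.
move=> /truncn_itv/andP[u1 u2] /truncn_itv/andP[v1 v2] uv.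
rewrite uv in u1 u2; rewrite -natr1 in u2 v2.
rewrite ltr_norml; lra.
Qed.

Lemma num_squares_le (R : realType) (N : nat)
  (hN : forall (a b : int), 1 <= b ->
    forall S : set int,
      (forall x, S x -> 0 < x /\ (x ^+ 2 = a %[mod b])%Z) ->
      (forall x y, S x -> S y -> (`|x - y|)%:~R < Num.sqrt (b%:~R : R)) ->
      (S #<= `I_N)%card) (a b : int) (k : nat) :
  0 < a -> 0 < b ->
  (num_squares a b k <= (Num.truncn (Num.sqrt (k%:R : R))).+1 * N)%N.
Proof.
move=> a0 b0.
have aR : 0 <= a%:~R :> R by rewrite ler0z ltW.
have bR : 0 < b%:~R :> R by rewrite ltr0z.
(* The implication sits under the existential so that choice gives a total function [r]; where the
   term is not a square, its value is irrelevant. *)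
have root_ex (i : 'I_k) : exists x : int, is_square (a + i.+1%:Z * b) ->
    0 < x /\ x ^+ 2 = a + i.+1%:Z * b.
  case: (pselect (is_square (a + i.+1%:Z * b))) => [[m me]|]; last by exists 0.
  exists `|m| => _; rewrite real_normK ?num_real // -me; split => //.
  by rewrite normr_gt0 -sqrf_eq0 -me gt_eqF // addr_gt0 // mulr_gt0.
have [r rP] := choice root_ex.
(* Position of the root beyond [sqrt a] in units of [sqrt b]; its integer part is the block
   number. *)
pose u i : R := ((r i)%:~R - Num.sqrt a%:~R) / Num.sqrt b%:~R.
have u_ge0 (i : 'I_k) : is_square (a + i.+1%:Z * b) -> 0 <= u i.
  move=> /rP[r0 r2]; rewrite divr_ge0 ?sqrtr_ge0 // subr_ge0.
  rewrite -ler_sqr ?nnegrE ?sqrtr_ge0 ?ler0z ?(ltW r0) // sqr_sqrtr //.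
  by rewrite -rmorphXn /= r2 ler_int lerDl mulr_ge0 // ltW.
rewrite /num_squares.
apply: (card_le_fibers (g := fun i : 'I_k => Num.truncn (u i))) => [i|j].
  rewrite unfold_in => /asboolP sq; have [r0 r2] := rP _ sq.
  apply: sqrt_block_lt => //; first by rewrite ler0z ltW.
  rewrite -rmorphXn /= r2 rmorphD rmorphM /= lerD2l ler_wpM2r ?(ltW bR) //.
  by rewrite ler_nat.
(* Fix block [j]. Equal roots have equal squares, and [b] is nonzero, so the indices agree. *)
apply: (@card_le_inj_image _ _ _ r) => [i i'|].
  rewrite !inE => /andP[/asboolP sq _] /andP[/asboolP sq' _] rii'.
  have [_ r2] := rP _ sq; have [_ r2'] := rP _ sq'.
  move: r2; rewrite rii' r2' => /addrI /(mulIf (lt0r_neq0 b0)).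
  by case=> /esym/val_inj.
apply: (hN a b) => [|x|x y]; first by rewrite gtz0_ge1 in b0 *.
  move=> [i /= + <-]; rewrite !inE => /andP[/asboolP /rP[r0 r2] _].
  by split=> //; rewrite r2 addrC modzMDl.
move=> [i /= + <-] [i' /= + <-]; rewrite !inE.
move=> /andP[/asboolP sq /eqP ij] /andP[/asboolP sq' /eqP i'j].
have := truncn_eq_dist (u_ge0 _ sq) (u_ge0 _ sq') (etrans ij (esym i'j)).
have sb0 : 0 < Num.sqrt b%:~R :> R by rewrite sqrtr_gt0.
(* The offsets [sqrt a] cancel, so positions less than 1 apart mean roots less than [sqrt b]
   apart. *)
rewrite /u -mulrBl opprB addrA subrK normrM normfV (gtr0_norm sb0).
by rewrite ltr_pdivrMr // mul1r intr_norm rmorphB.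
Qed.

Theorem theorem11 (R : realType)
  (hN : exists N : nat, forall (a b : int), 1 <= b ->
    forall S : set int,
      (forall x, S x -> 0 < x /\ (x ^+ 2 = a %[mod b])%Z) ->
      (forall x y, S x -> S y -> (`|x - y|)%:~R < Num.sqrt (b%:~R : R)) ->
      (S #<= `I_N)%card) :
  exists C : R, forall k : nat, (1 <= k)%N ->
    (sigma k)%:R <= C * Num.sqrt (k%:R : R).
Proof.
(* The factor 2 absorbs the extra block: [sqrt k + 1 <= 2 * sqrt k] because [1 <= k]. *)
have [N NP] := hN; exists (2 * N%:R) => k k1.
rewrite /sigma; case: ex_maxnP => m /asboolP[a [b [a0 b0 <-]]] _.
have s1 : 1 <= Num.sqrt (k%:R : R) by rewrite -[leLHS]sqrtr1 ler_wsqrtr // ler1n.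
have := num_squares_le NP k a0 b0; rewrite -(ler_nat R) => /le_trans; apply.
rewrite natrM mulrAC ler_wpM2r // -natr1.
have : (Num.truncn (Num.sqrt (k%:R : R)))%:R <= Num.sqrt (k%:R : R).
  by rewrite truncn_le sqrtr_ge0.
lra.
Qed.
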